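(* Fix integers $K\ge 3$ and $d\ge 1$. There exists a constant $C_{d,K}$, depending only on $d$ and $K$ (in particular independent of $n$ and $f$), such that the following holds for every $n\ge 1$. Suppose that $f:\Omega_K^n\to\mathbf{C}$ is a polynomial of degree at most $d$ with maximum support size $L$. For $0\le\ell\le L$ let $f_\ell$ denote the part of $f$ composed of monomials of support size $\ell$, and let $g_{(\ell,1)},\ldots,g_{(\ell,J_\ell)}$ be the inseparable parts of $f_\ell$. Then for all $0\le\ell\le L$ and $1\le j\le J_\ell$, $$\|g_{(\ell,j)}\|_{\Omega_K^n}\le C_{d,K}\,\|f\|_{\Omega_K^n}.$$
   Context: $\Omega_K=\{1,\omega,\dots,\omega^{K-1}\}$ with $\omega=e^{2\pi i/K}$. A polynomial $f:\Omega_K^n\to\mathbf{C}$ is written in its unique Fourier expansion $f(z)=\sum_{\alpha\in\{0,1,\dots,K-1\}^n}a_\alpha z^\alpha$, $z^\alpha=\prod_j z_j^{\alpha_j}$; the monomials in $f$ are the $z^\alpha$ with $a_\alpha\neq 0$, and $f$ has degree at most $d$ if $a_\alpha=0$ whenever $|\alpha|:=\sum_j\alpha_j>d$. The support of $z^\alpha$ is $\mathrm{supp}(\alpha)=\{j:\alpha_j\ne0\}$, and its support size is $|\mathrm{supp}(\alpha)|$; the maximum support size of $f$ is the largest support size of a monomial in $f$. For $\alpha\in\{0,\dots,K-1\}^n$ put $\tau_\alpha=\prod_{j:\alpha_j\neq0}(1-\omega^{\alpha_j})$. Two monomials $z^\alpha,z^\beta$ (with $\alpha,\beta\in\{0,\dots,K-1\}^n$)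 are called inseparable if $|\mathrm{supp}(\alpha)|=|\mathrm{supp}(\beta)|$ and $\tau_\alpha=\tau_\beta$. This is an equivalence relation on monomials. The inseparable parts of a polynomial $h$ are the polynomials $g_j$ obtained by splitting $h=\sum_j g_j$ according to this relation: each $g_j$ collects all terms $a_\alpha z^\alpha$ of $h$ whose monomials lie in one equivalence class, so two monomials in $h$ are inseparable if and only if they belong to the same $g_j$. For a set $X$, $\|f\|_X:=\sup_{x\in X}|f(x)|$. *)

(* Defs.v *)
From HB Require Import structures.
From mathcomp Require Import all_boot all_order all_algebra.
From mathcomp Require Import complex.
From mathcomp Require Import boolp classical_sets reals trigo.

Set Implicit Arguments.
Unset Strict Implicit.
Unset Printing Implicit Defensive.

Import Order.TTheory GRing.Theory Num.Theory.

Local Open Scope classical_set_scope.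
Local Open Scope complex_scope.
Local Open Scope ring_scope.

Section RootsOfUnity.
Variables (R : realType) (K : nat).

Definition omega : R[i] := cos (2 * pi / K%:R) +i* sin (2 * pi / K%:R).

Definition Omega : set R[i] := [set omega ^+ k | k in [set k | (k < K)%N]].

Definition Omega_pow (n : nat) : set ('I_n -> R[i]) :=
  [set z | forall j, Omega (z j)].

End RootsOfUnity.

Arguments Omega : clear implicits.
Arguments Omega_pow : clear implicits.

(* [ComplexField.Normc.normc] is the [R]-valued modulus; [`|z|] would live in [R[i]]. *)
Definition sup_norm (R : realType) (T : Type) (X : set T) (f : T -> R[i]) : R :=
  sup [set ComplexField.Normc.normc (f x) | x in X].

Section Polynomials.
Variables (R : realType) (K n : nat).

Definition exponent := {ffun 'I_n -> 'I_K}.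

(* A polynomial on Omega_K^n, given by its Fourier coefficients. *)
Definition omega_poly := {ffun exponent -> R[i]}.

Implicit Types (al be : exponent) (a h : omega_poly) (z : 'I_n -> R[i]).

Definition monomial_eval al z : R[i] := \prod_(j < n) z j ^+ al j.

Definition poly_eval a z : R[i] := \sum_al a al * monomial_eval al z.

Definition fourier_expansion (f : ('I_n -> R[i]) -> R[i]) a : Prop :=
  forall z, Omega_pow R K n z -> f z = poly_eval a z.

Definition monomials a : {set exponent} := [set al | a al != 0]%SET.

Definition total_degree al : nat := (\sum_(j < n) al j)%N.

Definition degree_at_most (d : nat) a : Prop :=
  forall al, (d < total_degree al)%N -> a al = 0.

Definition supp al : {set 'I_n} := [set j | al j != 0%N :> nat]%SET.

(* The value is 0 when [a] has no monomial. *)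
Definition max_supp_size a : nat := (\max_(al in monomials a) #|supp al|)%N.

Definition restrict_poly a (B : {set exponent}) : omega_poly :=
  [ffun al => if al \in B then a al else 0].

Definition supp_size_part (l : nat) a : omega_poly :=
  restrict_poly a [set al | #|supp al| == l]%SET.

Definition tau al : R[i] := \prod_(j in supp al) (1 - omega R K ^+ al j).

Definition inseparable : rel exponent :=
  fun al be => (#|supp al| == #|supp be|) && (tau al == tau be).

Lemma inseparable_equiv : equivalence_rel inseparable.
Proof.
move=> x y z; rewrite /inseparable !eqxx; split=> //.
by case/andP=> /eqP -> /eqP ->.
Qed.

Definition inseparable_parts h : seq omega_poly :=
  [seq restrict_poly h B
  | B <- enum (equivalence_partition inseparable (monomials h))].

Lemma sum_inseparable_parts h z :
  poly_eval h z = \sum_(g <- inseparable_parts h) poly_eval g z.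
Proof.
rewrite /inseparable_parts big_map big_enum /=.
set P := equivalence_partition _ _.
have /and3P[/eqP covP trivP _] : finset.partition P (monomials h).
  by apply: finset.equivalence_partitionP => x y w _ _ _; exact: inseparable_equiv.
transitivity (\sum_(al in monomials h) h al * monomial_eval al z).
  rewrite /poly_eval (bigID (mem (monomials h))) /= [X in _ + X]big1 ?addr0 //.
  by move=> al; rewrite inE negbK => /eqP ->; rewrite mul0r.
rewrite -covP finset.big_trivIset //=; apply: eq_bigr => B _.
rewrite /poly_eval big_mkcond /=; apply: eq_bigr => al _.
by rewrite ffunE; case: ifP; rewrite ?mul0r.
Qed.

End Polynomials.

(* Main.v *)
(** Attach to [z^alpha] the polynomial
    [Phi_alpha(t) = \prod_j (1 - (1 - omega^(alpha_j)) t)]; its size and leading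
    coefficient encode [|supp alpha|] and [tau_alpha], so inseparability depends
    on [Phi_alpha] alone. For [t] in [0, 1], multiplying each Fourier coefficient
    by [Phi_alpha(t)] averages [f] over independent [y_j] equal to [omega z_j]
    with probability [t] and to [z_j] otherwise, hence is a contraction of the
    sup norm. In degree at most [d] only finitely many [Phi_alpha] occur,
    independently of [n], and distinct ones differ at some [t] in [0, 1]. By
    Lagrange interpolation, any multiplier depending only on [Phi_alpha] is a
    polynomial in these contractions, with coefficients independent of [n]. *)

Require Import Defs.
From HB Require Import structures.
From mathcomp Require Import all_boot all_order all_algebra.
From mathcomp Require Import complex.
From mathcomp Require Import boolp classical_sets reals trigo.
From mathcomp Require Import ring.

Import Order.TTheory GRing.Theory Num.Theory.

Local Open Scope ring_scope.

Section Multipliers.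
Set Implicit Arguments.
Unset Strict Implicit.
Variables (R : realType) (K : nat).
Hypothesis K_gt1 : (1 < K)%N.

Local Notation w := (omega R K).

(** * Powers of [omega] and the set [Omega] *)

Lemma omega_expr k :
  w ^+ k = (cos (k%:R * (2 * pi / K%:R)) +i* sin (k%:R * (2 * pi / K%:R)))%C.
Proof.
rewrite /omega; set x := 2 * pi / _.
elim: k => [|k IHk]; first by rewrite mul0r cos0 sin0 expr0.
rewrite exprSr IHk -[k.+1%:R]natr1 mulrDl mul1r cosD sinD; simpc.
by congr (_ +i* _)%C; rewrite addrC.
Qed.

Lemma omega_exprK : w ^+ K = 1.
Proof.
rewrite omega_expr mulrC divfK ?pnatr_eq0 -?lt0n ?(ltnW K_gt1) //.
by rewrite mulrC mulr_natr cos2pi sin2pi.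
Qed.

Lemma omega_expr_neq1 k : (0 < k < K)%N -> w ^+ k != 1.
Proof.
case/andP=> k0 kK; apply/eqP; rewrite omega_expr => -[].
set x := _ * _ => cx sx.
(* The half-angle formula turns [cos x = 1] into [sin (x / 2) = 0], which is impossible strictly
   between 0 and [pi]. *)
have x0 : 0 < x / 2.
  by rewrite /x !(mulr_gt0, divr_gt0, invr_gt0, ltr0n, pi_gt0) // (ltn_trans k0).
have xpi : x / 2 < pi.
  have -> : x / 2 = pi * (k%:R / K%:R).
    by rewrite /x; field; rewrite pnatr_eq0; case: (K) kK.
  rewrite -[ltRHS]mulr1 ltr_pM2l ?pi_gt0 // ltr_pdivrMr ?mul1r ?ltr_nat //.
  by rewrite ltr0n (ltn_trans k0).
have := @sin_gt0_pi _ (x / 2); rewrite x0 xpi => /(_ isT).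
have : cos x = 1 - 2 * sin (x / 2) ^+ 2.
  have {1}-> : x = x / 2 + x / 2 by rewrite -splitr.
  by rewrite cosD -!expr2 cos2sin2; ring.
rewrite cx => /eqP; rewrite -subr_eq0 subKr mulf_eq0.
by rewrite pnatr_eq0 /= sqrf_eq0 => /eqP ->; rewrite ltxx.
Qed.

Lemma Omega1 : Omega R K 1.
Proof. by exists 0%N; rewrite /= ?(ltnW K_gt1). Qed.

Lemma Omega_omegaM x : Omega R K x -> Omega R K (w * x).
Proof.
case=> k /= kK <-; rewrite -exprS; move: kK; rewrite leq_eqVlt => /orP[/eqP ->|kK].
  by rewrite omega_exprK; exact: Omega1.
by exists k.+1.
Qed.

Lemma normr_Omega x : Omega R K x -> `|x| = 1.
Proof.
case=> k /= _ <-; rewrite normrX.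
suff -> : `|w| = 1 by rewrite expr1n.
by rewrite normc_def /= cos2Dsin2 sqrtr1.
Qed.

(** * The polynomial attached to a monomial *)

Definition linear_factor k : {poly R[i]} := 1 - (1 - w ^+ k)%:P * 'X.

Lemma linear_factor0 : linear_factor 0 = 1.
Proof. by rewrite /linear_factor expr0 subrr mul0r subr0. Qed.

(** For [t] in [0, 1] this is the mean of a variable equal to [w ^+ k] with probability [t] and to 1
    otherwise. *)
Lemma linear_factorE k (t : R[i]) :
  (linear_factor k).[t] = (1 - t) + t * w ^+ k.
Proof. by rewrite /linear_factor !hornerE; ring. Qed.

Lemma linear_factor_lead k : (0 < k < K)%N ->
  size (linear_factor k) = 2%N /\ lead_coef (linear_factor k) = - (1 - w ^+ k).
Proof.
move=> kK.
have u0 : - (1 - w ^+ k) != 0 by rewrite oppr_eq0 subr_eq0 eq_sym omega_expr_neq1.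
have -> : linear_factor k = (- (1 - w ^+ k))%:P * 'X + 1%:P.
  by rewrite /linear_factor addrC polyCN mulNr.
split; first by rewrite size_MXaddC polyC_eq0 (negbTE u0) size_polyC u0.
rewrite lead_coefDl ?lead_coefMX ?lead_coefC // size_mulX ?polyC_eq0 //.
by rewrite !size_polyC u0 oner_eq0.
Qed.

Definition type_poly n (al : exponent K n) : {poly R[i]} :=
  \prod_(j < n) linear_factor (al j).

Lemma type_poly_supp n (al : exponent K n) :
  type_poly al = \prod_(j in supp al) linear_factor (al j).
Proof.
rewrite /type_poly [RHS]big_mkcond /=; apply: eq_bigr => j _.
by rewrite inE; case: eqP => //= ->; rewrite linear_factor0.
Qed.

Lemma type_poly_lead n (al : exponent K n) :
  size (type_poly al) = #|supp al|.+1 /\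
  lead_coef (type_poly al) = (-1) ^+ #|supp al| * tau R al.
Proof.
have F j : j \in supp al -> (0 < al j < K)%N.
  by rewrite inE lt0n ltn_ord andbT.
rewrite type_poly_supp; split.
  rewrite size_prod => [|j /F/linear_factor_lead[sz _]]; last first.
    by rewrite -size_poly_eq0 sz.
  rewrite (eq_bigr (fun=> 2%N)) => [|j /F/linear_factor_lead[]//].
  (* The size of a product of m nonzero factors is the sum of their sizes plus 1 minus m, here 2m +
     1 - m. *)
  by rewrite sum_nat_const muln2 -addnn -addSn addnK.
rewrite lead_coef_prod /tau -prodrN.
by apply: eq_bigr => j /F/linear_factor_lead[].
Qed.

(** Once the sizes agree, the signs [(-1) ^+ #|supp al|] in the leading coefficients cancel and
    leave [tau]. *)
Lemma inseparable_type_poly n (al be : exponent K n) :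
  inseparable R al be = (size (type_poly al) == size (type_poly be)) &&
    (lead_coef (type_poly al) == lead_coef (type_poly be)).
Proof.
have [-> ->] := type_poly_lead al; have [-> ->] := type_poly_lead be.
rewrite eqSS /inseparable; case: eqP => //= ->.
by rewrite (inj_eq (mulfI _)) // expf_neq0 // oppr_eq0 oner_eq0.
Qed.

Lemma card_supp_le n (al : exponent K n) : (#|supp al| <= total_degree al)%N.
Proof.
rewrite /total_degree -sum1_card [leqLHS]big_mkcond /=; apply: leq_sum => j _.
by rewrite inE; case: eqP => // /eqP; rewrite lt0n.
Qed.

(** * Multipliers and their operator bounds *)

Definition multiply {n} (m : {poly R[i]} -> R[i]) (a : omega_poly R K n) :
    omega_poly R K n :=
  [ffun al => m (type_poly al) * a al].

(** Expanding the product of the factors [(1 - t) + t * w ^+ al j] gives a sum over the choices [s]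
    of coordinates rotated by [w]. *)
Lemma average_type_poly n (a : omega_poly R K n) (t : R[i]) z :
  poly_eval (multiply (horner^~ t) a) z =
  \sum_(s : {ffun 'I_n -> bool}) (\prod_j (if s j then t else 1 - t)) *
    poly_eval a (fun j => if s j then w * z j else z j).
Proof.
rewrite /poly_eval; under [RHS]eq_bigr do rewrite mulr_sumr.
rewrite exchange_big /=; apply: eq_bigr => al _; rewrite ffunE.
rewrite /type_poly horner_prod.
under eq_bigr => j _.
  rewrite linear_factorE addrC.
  rewrite (_ : t * _ + _ =
    \sum_(b : bool) (if b then t * w ^+ al j else 1 - t)); last first.
    by rewrite big_bool.
  over.
rewrite bigA_distr_bigA /= !mulr_suml; apply: eq_bigr => s _.
rewrite -mulrA mulrCA [RHS]mulrCA; congr (_ * _).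
rewrite -!big_split /=; apply: eq_bigr => j _.
by case: (s j) => //; rewrite exprMn mulrA.
Qed.

Variable d : nat.

(** [C] is chosen before [n], [a] and [M], which is the required uniformity. An arbitrary bound [M]
    stands for the sup norm, so that bounds chain without handling suprema. *)
Definition bounded_multiplier (m : {poly R[i]} -> R[i]) : Prop :=
  exists2 C : R[i], 0 <= C & forall n (a : omega_poly R K n) (M : R[i]),
    degree_at_most d a ->
    (forall z, Omega_pow R K n z -> `|poly_eval a z| <= M) ->
    forall z, Omega_pow R K n z -> `|poly_eval (multiply m a) z| <= C * M.

Lemma bounded_horner (t : R[i]) : 0 <= t <= 1 -> bounded_multiplier (horner^~ t).
Proof.
case/andP=> t0 t1; exists 1 => // n a M _ aM z zO; rewrite mul1r average_type_poly.
(* [W s] is the probability that exactly the coordinates marked by [s] are rotated. *)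
pose W (s : {ffun 'I_n -> bool}) : R[i] := \prod_j (if s j then t else 1 - t).
have W0 s : 0 <= W s by apply: prodr_ge0 => j _; case: ifP; rewrite ?subr_ge0.
have W1 : \sum_s W s = 1.
  rewrite /W -(bigA_distr_bigA (fun (_ : 'I_n) b => if b then t else 1 - t)) /=.
  by apply: big1 => j _; rewrite big_bool /= addrC subrK.
have -> : M = \sum_s W s * M by rewrite -mulr_suml W1 mul1r.
apply: le_trans (ler_norm_sum _ _ _) _; apply: ler_sum => s _.
rewrite normrM (ger0_norm (W0 s)) ler_wpM2l ?W0 //.
by apply: aM => j; case: (s j); [apply: Omega_omegaM|]; exact: zO.
Qed.

Lemma bounded_cst c : bounded_multiplier (fun=> c).
Proof.
exists `|c| => // n a M _ aM z zO.
have -> : poly_eval (multiply (fun=> c) a) z = c * poly_eval a z.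
  by rewrite /poly_eval mulr_sumr; apply: eq_bigr => al _; rewrite ffunE mulrA.
by rewrite normrM ler_wpM2l ?aM.
Qed.

Lemma bounded_add m1 m2 : bounded_multiplier m1 -> bounded_multiplier m2 ->
  bounded_multiplier (fun p => m1 p + m2 p).
Proof.
case=> C1 C1_ge0 H1 [C2 C2_ge0 H2]; exists (C1 + C2); first exact: addr_ge0.
move=> n a M ad aM z zO.
have -> : poly_eval (multiply (fun p => m1 p + m2 p) a) z =
    poly_eval (multiply m1 a) z + poly_eval (multiply m2 a) z.
  by rewrite /poly_eval -big_split; apply: eq_bigr => al _; rewrite !ffunE !mulrDl.
by rewrite mulrDl (le_trans (ler_normD _ _)) // lerD ?H1 ?H2.
Qed.

(** A product of multipliers acts by composition; [m2] only rescales coefficients, so the degree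
    bound survives for [m1]. *)
Lemma bounded_mul m1 m2 : bounded_multiplier m1 -> bounded_multiplier m2 ->
  bounded_multiplier (fun p => m1 p * m2 p).
Proof.
case=> C1 C1_ge0 H1 [C2 C2_ge0 H2]; exists (C1 * C2); first exact: mulr_ge0.
move=> n a M ad aM z zO.
have -> : multiply (fun p => m1 p * m2 p) a = multiply m1 (multiply m2 a).
  by apply/ffunP => al; rewrite !ffunE mulrA.
rewrite -mulrA; apply: H1 => // [al dal|y yO]; last exact: H2.
by rewrite ffunE ad ?mulr0.
Qed.

Lemma bounded_sum (I : Type) (r : seq I) (m : I -> {poly R[i]} -> R[i]) :
  (forall i, bounded_multiplier (m i)) ->
  bounded_multiplier (fun p => \sum_(i <- r) m i p).
Proof.
move=> mb; elim: r => [|i r IHr].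
  by under eq_fun do rewrite big_nil; exact: bounded_cst.
by under eq_fun do rewrite big_cons; exact: bounded_add.
Qed.

Lemma bounded_prod (I : Type) (r : seq I) (m : I -> {poly R[i]} -> R[i]) :
  (forall i, bounded_multiplier (m i)) ->
  bounded_multiplier (fun p => \prod_(i <- r) m i p).
Proof.
move=> mb; elim: r => [|i r IHr].
  by under eq_fun do rewrite big_nil; exact: bounded_cst.
by under eq_fun do rewrite big_cons; exact: bounded_mul.
Qed.

(* Trivial factors are dropped, so that [n] does not appear. *)
Definition type_polys : seq {poly R[i]} :=
  undup [seq \prod_(k <- s) linear_factor (nat_of_ord k) | s : d.-bseq 'I_K].

Lemma mem_type_polys n (al : exponent K n) :
  (total_degree al <= d)%N -> type_poly al \in type_polys.
Proof.
move=> ald; rewrite mem_undup; apply/mapP.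
have sz : (size [seq al j | j <- enum (supp al)] <= d)%N.
  by rewrite size_map -cardE (leq_trans (card_supp_le al)).
by exists (Bseq sz); rewrite ?mem_enum // big_map big_enum type_poly_supp.
Qed.

(** Coefficients beyond degree [d] vanish, so interpolating on the finite list [type_polys] is
    enough. *)
Lemma eq_bounded_multiplier m1 m2 : {in type_polys, m1 =1 m2} ->
  bounded_multiplier m1 -> bounded_multiplier m2.
Proof.
move=> m12 [C C0 H]; exists C => // n a M ad aM.
have <- : multiply m1 a = multiply m2 a; last exact: H.
apply/ffunP => al; rewrite !ffunE; have [ald|ald] := leqP (total_degree al) d.
  by rewrite m12 ?mem_type_polys.
by rewrite ad ?mulr0.
Qed.

(** * Separation and Lagrange interpolation *)

(** Otherwise every reciprocal of a positive integer would be a root of [p - q], and [size (p - q)]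
    distinct roots are too many for a nonzero polynomial. *)
Lemma poly_separation (p q : {poly R[i]}) : p != q ->
  exists2 t : R[i], 0 <= t <= 1 & p.[t] != q.[t].
Proof.
move=> pq; apply: contrapT => H.
have {}H (k : nat) : root (p - q) (k.+1%:R^-1).
  rewrite /root !hornerE subr_eq0; apply: contrapT => /negP Hk; apply: H.
  by exists k.+1%:R^-1; rewrite // invr_ge0 ler0n /= invf_le1 ?ler1n ?ltr0n.
pose rs := [seq k.+1%:R^-1 : R[i] | k <- iota 0 (size (p - q))].
have : (size rs < size (p - q)%R)%N.
  apply: max_poly_roots; first by rewrite subr_eq0.
    by apply/allP => _ /mapP[k _ ->].
  rewrite map_inj_uniq ?iota_uniq // => i j /invr_inj /eqP.
  by rewrite eqr_nat eqSS => /eqP.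
by rewrite size_map size_iota ltnn.
Qed.

(** An affine rescaling of evaluation at a separating point. The case [q = p] is included so that
    Lagrange products can run over the whole list. *)
Lemma bounded_separation p q : exists2 m, bounded_multiplier m &
  m p = 1 /\ (q != p -> m q = 0).
Proof.
have [->|qp] := eqVneq q p.
  by exists (fun=> 1); [exact: bounded_cst|split].
have [t t01 qpt] := poly_separation qp.
exists (fun r => (p.[t] - q.[t])^-1 * (r.[t] - q.[t])).
  apply: bounded_mul (bounded_cst _) _.
  by apply: bounded_add; [exact: bounded_horner|exact: bounded_cst].
by rewrite mulVf ?subrr ?mulr0 // subr_eq0 eq_sym.
Qed.

Lemma all_bounded_multiplier m : bounded_multiplier m.
Proof.
have H (pq : {poly R[i]} * {poly R[i]}) : {m | bounded_multiplier m &
    m pq.1 = 1 /\ (pq.2 != pq.1 -> m pq.2 = 0)}.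
  by apply: cid2; exact: bounded_separation.
pose e p q := s2val (H (p, q)).
(* At [r = p] every factor is 1; at any other [r] of the list the factor indexed by [q = r]
   vanishes. *)
pose lagrange p r := \prod_(q <- type_polys) e p q r.
apply: (@eq_bounded_multiplier
  (fun r => \sum_(p <- type_polys) m p * lagrange p r)).
  move=> r rT; rewrite (bigD1_seq r) ?undup_uniq //= big1 => [|p pr].
    rewrite addr0 /lagrange big1 ?mulr1 // => q _.
    by rewrite /e; case: (H (r, q)) => f ? [].
  rewrite /lagrange (bigD1_seq r) ?undup_uniq //= /e.
  by case: (H (p, r)) => f /= _ [_ ->]; rewrite ?mul0r ?mulr0 // eq_sym.
apply: bounded_sum => p; apply: bounded_mul (bounded_cst _) _.
by apply: bounded_prod => q; rewrite /e; case: (H (p, q)).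
Qed.

(** * Inseparable parts as images of multipliers *)

(** A representative [al] of the class has support size [l] and [a al != 0], hence degree at most
    [d]. Take [p = type_poly al]: the test on sizes also performs the restriction to support size
    [l]. *)
Lemma inseparable_part_multiply n (a : omega_poly R K n) l g :
  degree_at_most d a -> g \in inseparable_parts (supp_size_part l a) ->
  exists2 p, p \in type_polys &
    g = multiply
      (fun q => ((size p == size q) && (lead_coef p == lead_coef q))%:R) a.
Proof.
move=> ad /mapP[B]; rewrite mem_enum => /imsetP[al alh ->] ->.
move: (alh); rewrite !inE ffunE inE; case: ifP => [/eqP all ala|_]; last first.
  by rewrite eqxx.
exists (type_poly al).
  by apply: mem_type_polys; rewrite leqNgt; apply: contra ala => /ad ->.
apply/ffunP => be; rewrite !ffunE !inE !ffunE !inE -inseparable_type_poly.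
rewrite /inseparable -all [_ == #|supp be|]eq_sym.
have [ab|] := eqVneq #|supp be| #|supp al|; last by rewrite eqxx /= mul0r.
have [->|abe] := eqVneq (a be) 0; first by rewrite /= mulr0.
by rewrite /=; case: eqP; rewrite ?mul1r ?mul0r.
Qed.

Lemma bounded_inseparable_part : exists2 C : R[i], 0 <= C &
  forall n (a : omega_poly R K n) (M : R[i]) l g, degree_at_most d a ->
    g \in inseparable_parts (supp_size_part l a) ->
    (forall z, Omega_pow R K n z -> `|poly_eval a z| <= M) ->
    forall z, Omega_pow R K n z -> `|poly_eval g z| <= C * M.
Proof.
pose mu (p q : {poly R[i]}) : R[i] :=
  ((size p == size q) && (lead_coef p == lead_coef q))%:R.
have H p := cid2 (all_bounded_multiplier (mu p)).
have c0 p : 0 <= s2val (H p) by case: (H p).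
(* The constant for [p] depends on the part; the sum over the finite list dominates them all. *)
exists (\sum_(p <- type_polys) s2val (H p)); first by apply: sumr_ge0.
move=> n a M l g ad /(inseparable_part_multiply ad)[p pT ->] aM z zO.
have M0 : 0 <= M by apply: le_trans (aM z zO).
apply: (@le_trans _ _ (s2val (H p) * M)).
  by case: (H p) => C /= _; apply.
by rewrite ler_wpM2r // (bigD1_seq p) ?undup_uniq //= lerDl sumr_ge0.
Qed.

(** This crude bound depends on [a]; it serves to show that the supremum defining [sup_norm] is
    taken over a bounded set. *)
Lemma poly_eval_le n (a : omega_poly R K n) z : Omega_pow R K n z ->
  `|poly_eval a z| <= \sum_al `|a al|.
Proof.
move=> zO; apply: le_trans (ler_norm_sum _ _ _) _; apply: ler_sum => al _.
rewrite normrM /monomial_eval normr_prod big1 ?mulr1 // => j _.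
by rewrite normrX normr_Omega // expr1n.
Qed.

End Multipliers.

Lemma normcE (R : realType) (x : R[i]) : `|x| = (ComplexField.Normc.normc x)%:C%C.
Proof. by []. Qed.

Theorem proposition3 (R : realType) (K d : nat)
    (hK : (3 <= K)%N) (hd : (1 <= d)%N) :
  exists C : R,
    forall (n : nat) (f : ('I_n -> R[i]) -> R[i]) (a : omega_poly R K n)
           (L : nat),
      (1 <= n)%N ->
      fourier_expansion f a ->
      degree_at_most d a ->
      max_supp_size a = L ->
      forall l : nat, (l <= L)%N ->
      forall g : omega_poly R K n,
        g \in inseparable_parts (supp_size_part l a) ->
        sup_norm (Omega_pow R K n) (poly_eval g)
          <= C * sup_norm (Omega_pow R K n) f.
Proof.
have K1 : (1 < K)%N by apply: leq_trans hK.
have [C C0 HC] := bounded_inseparable_part R K1 d.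
(* Being nonnegative in [R[i]], [C] is real, so its real part is the constant sought in [R]. *)
have CE : C = (complex.Re C)%:C%C by rewrite RRe_real ?ger0_real.
exists (complex.Re C) => n f a L _ fa ad _ l _ g gP.
apply: ge_sup => [|_ [z zO <-]].
  (* Bounding a supremum requires a nonempty set, witnessed by the constant point 1. *)
  by eexists; exists (fun=> 1) => // j; exact: Omega1.
rewrite -lecR rmorphM /= -CE -normcE; apply: (HC n a _ l) => // y yO.
rewrite -fa // normcE lecR; apply: ub_le_sup; last by exists y.
exists (complex.Re (\sum_al `|a al|)) => _ [x xO <-].
rewrite -lecR RRe_real ?ger0_real ?sumr_ge0 // -normcE fa //.
exact: poly_eval_le.
Qed.
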